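(* Let $\lambda/\mu$ and $\gamma/\nu$ be skew shapes, and suppose $g_{\lambda/\mu}=g_{\gamma/\nu}$ (so that both shapes have the same number $n$ of columns). Then \[ \sum_{i=1}^n (b_i^{\lambda/\mu})^2=\sum_{i=1}^n (b_i^{\gamma/\nu})^2 . \]
   Context: A skew shape $\lambda/\mu$ is a pair of partitions with $\mu_i\le\lambda_i$ for all $i$; its Young diagram (English notation, rows numbered from top to bottom, columns from left to right) consists of the boxes in the Young diagram of $\lambda$ that are not in that of $\mu$. Diagrams are considered up to translation, and the rows and columns of a shape mean its nonempty rows and columns, numbered consecutively. A reverse plane partition of shape $\lambda/\mu$ is a filling of the boxes with positive integers that weakly increase from left to right across rows and weakly increase from top to bottom down columns. Its monomial is $x^P=\prod_{i\ge1}x_i^{m_i}$, where $m_i$ is the number of columns of $P$ containing the integer $i$. The dual stable Grothendieck polynomial is $g_{\lambda/\mu}=\sum_P x^P$, summed over all reverse plane partitions of shape $\lambda/\mu$. An interior horizontal edge is a horizontal edge of a box in the diagram lying neither at the top boundary nor at the bottom boundary of the diagram. A bottleneck edge is an interior horizontal edge touching both the left and right boundaries of the shape. The bottleneck number $b_i^{\lambda/\mu}$ is the number of bottleneck edges in column $i$. Equivalently, if the shape occupies rows $1,\dots,m$ and columns $1,\dots,n$, all nonempty, then \[ b_i^{\lambda/\mu}=|\{1\le j\le m-1 \mid \mu_j=i-1,\ \lambda_{j+1}=i\}|, \] where $\mu_j=0$ when $j$ exceeds the number of parts of $\mu$. *)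

(* Defs.v *)
From HB Require Import structures.
From mathcomp Require Import all_boot all_algebra finmap.
From mathcomp Require Import monalg.
From mathcomp Require Import boolp classical_sets functions cardinality fsbigop.

Set Implicit Arguments.
Unset Strict Implicit.
Unset Printing Implicit Defensive.

Import GRing.Theory.

Local Open Scope nat_scope.

(* Rows and columns are numbered from 0: box (r, c) is the box in row r + 1 and
   column c + 1.  A part past the end of a partition is 0. *)

Definition is_partition (la : seq nat) : bool :=
  sorted geq la && (0 \notin la).

Definition is_skew_shape (la mu : seq nat) : Prop :=
  [/\ is_partition la, is_partition mu & forall i, nth 0 mu i <= nth 0 la i].

Definition in_skew (la mu : seq nat) (r c : nat) : bool :=
  nth 0 mu r <= c < nth 0 la r.

Definition box (la mu : seq nat) : finType :=
  {rc : 'I_(size la) * 'I_(head 0 la) | in_skew la mu rc.1 rc.2}.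

Section ReversePlanePartitions.
Variables la mu : seq nat.

Definition row_of (b : box la mu) : 'I_(size la) := (val b).1.
Definition col_of (b : box la mu) : 'I_(head 0 la) := (val b).2.

Definition rpp : set {ffun box la mu -> nat} :=
  [set P : {ffun box la mu -> nat} |
           [/\ forall b, 0 < P b,
               forall b b', row_of b = row_of b' -> col_of b <= col_of b' ->
                 P b <= P b' &
               forall b b', col_of b = col_of b' -> row_of b <= row_of b' ->
                 P b <= P b']]%classic.

Definition cols_containing (P : {ffun box la mu -> nat}) (i : nat) :
    {set 'I_(head 0 la)} :=
  [set col_of b | b in [pred b | P b == i]].

(* The variables x_i are indexed by all of nat, but x_0 never occurs. *)
Definition rpp_monomial (P : {ffun box la mu -> nat}) : {cmonom nat} :=
  [cmonom #|cols_containing P i| | i in [fset P b | b : box la mu]%fset]%M.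

(* A formal power series in infinitely many variables is given by its
   coefficients; by finite_rpp_monomial below the sum is finite. *)
Definition dual_grothendieck : {cmonom nat} -> int :=
  fun m => (\sum_(P \in rpp) ((rpp_monomial P == m)%:R : int))%R.

End ReversePlanePartitions.

Definition nonempty_cols (la mu : seq nat) : seq nat :=
  [seq c <- iota 0 (head 0 la) | has (in_skew la mu ^~ c) (iota 0 (size la))].

Definition ncols (la mu : seq nat) : nat := size (nonempty_cols la mu).

(* The edge between the boxes (r, c) and (r + 1, c).  It is interior iff both
   boxes are in the diagram.  Since both boundaries move weakly to the left from
   row r to row r + 1, it touches the left boundary iff row r starts in column
   c, and the right boundary iff row r + 1 ends in column c. *)
Definition bottleneck_edge (la mu : seq nat) (r c : nat) : bool :=
  [&& in_skew la mu r c, in_skew la mu r.+1 c,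
      nth 0 mu r == c & nth 0 la r.+1 == c.+1].

(* The index i runs over the nonempty columns, numbered consecutively.  Empty
   rows need no renumbering: two rows separated by an empty row have no column
   in common. *)
Definition bottleneck (la mu : seq nat) (i : nat) : nat :=
  count (bottleneck_edge la mu ^~ (nth 0 (nonempty_cols la mu) i))
        (iota 0 (size la)).

Lemma rpp_monomialE la mu (P : {ffun box la mu -> nat}) i :
  rpp_monomial P i = #|cols_containing P i|.
Proof.
rewrite /rpp_monomial cmE fsfunE; case: ifP => // Pi.
apply/esym/eq_card0 => c; apply/negP => /imsetP[b].
rewrite inE => /eqP Pb _; move/negP: Pi; apply.
by apply/imfsetP; exists b.
Qed.

Lemma finite_rpp_monomial la mu (m : {cmonom nat}) :
  finite_set [set P | rpp (la := la) (mu := mu) P /\ rpp_monomial P = m]%classic.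
Proof.
pose N := (\max_(i <- finsupp m) i).+1.
pose h (Q : {ffun box la mu -> 'I_N}) : {ffun box la mu -> nat} :=
  [ffun b => val (Q b)].
apply: (@sub_finite_set _ _ (h @` setT)%classic); last first.
  exact/finite_image/finite_finset.
move=> P [_ Pm]; exists [ffun b => inord (P b)] => //.
apply/ffunP => b; rewrite !ffunE /= inordK // ltnS.
have mPb : P b \in finsupp m.
  rewrite mem_finsupp -Pm rpp_monomialE cards_eq0; apply/set0Pn.
  by exists (col_of b); apply/imsetP; exists b => //; rewrite inE.
by rewrite (big_rem _ mPb) /= leq_maxl.
Qed.

(* The formula for b_(i+1) when the shape has no empty column: the number
   of rows j, other than the last, with mu_j = i and lambda_(j+1) = i + 1. *)
Lemma bottleneckE la mu i : is_skew_shape la mu ->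
  ncols la mu = head 0 la -> i < ncols la mu ->
  bottleneck la mu i =
  #|[set j : 'I_(size la).-1 | (nth 0 mu j == i) && (nth 0 la j.+1 == i.+1)]|.
Proof.
move=> [/andP[sla _] /andP[smu _] _] full ilt.
have nth_le s r : sorted geq s -> nth 0 s r.+1 <= nth 0 s r.
  move=> ss; have [lt_r|] := ltnP r.+1 (size s); last by move/(nth_default 0)->.
  by move/(sortedP 0): ss => /(_ r lt_r).
have colsE : nonempty_cols la mu = iota 0 (head 0 la).
  apply/all_filterP; rewrite all_count -size_filter size_iota.
  exact/eqP.
have edgeE r : bottleneck_edge la mu r i =
    (nth 0 mu r == i) && (nth 0 la r.+1 == i.+1).
  rewrite /bottleneck_edge /in_skew.
  case: eqP => [mur|]; last by rewrite !andbF.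
  case: eqP => [lar|]; last by rewrite !andbF.
  have := nth_le mu r smu; have := nth_le la r sla.
  by rewrite mur lar leqnn ltnSn => -> ->.
rewrite /bottleneck colsE nth_iota; last by rewrite -full.
rewrite add0n (eq_count edgeE) -sum1_count cardsE -sum1_card.
have -> : iota 0 (size la) = index_iota 0 (size la) by rewrite /index_iota subn0.
rewrite big_mkord; case sz: (size la) => [|n] /=.
  by rewrite !big_ord0.
have lastF : (nth 0 mu n == i) && (nth 0 la n.+1 == i.+1) = false.
  by apply/negP => /andP[_]; rewrite (nth_default 0) ?sz.
rewrite big_mkcond big_ord_recr /= lastF addn0 -big_mkcond.
exact: eq_bigl.
Qed.

(* Main.v *)
Require Import Defs.
From mathcomp Require Import all_boot all_algebra finmap.
From mathcomp Require Import monalg.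
From mathcomp Require classical_sets fsbigop.

(** Let K be the set of boxes having another box below them in the same
    column.  Row j of K occupies the columns shared by rows j and j + 1 of the
    shape, so the bottleneck edges in a column are the rows of K consisting of
    a single box in that column.  The proof reads the whole multiset of
    bottleneck numbers off g, by an alternating sum of coefficients that
    isolates K.

    A reverse plane partition with entries 1, ..., l is a chain of order ideals
    of the shape, so the coefficient of x_1^{a_1} ... x_l^{a_l} counts the
    chains whose i-th layer meets exactly a_i columns
    ([dual_grothendieck_word]).  Let U(t) be the matrix indexed by order ideals
    whose entry at I <= J is t to the number of columns meeting J \ I.  It is
    unitriangular, and summing the coefficients of the words a with weights
    (- t^{a_1}) ... (- t^{a_l}) expands U(t)^{-1} as the Neumann series of
    1 - U(t).  Appending a last letter n, the number of columns, forces the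
    chain to stop at an ideal contained in K.  So the sum over all words
    computes the row sums of U(t)^{-1} over the order ideals of K.  These are
    given by the identity ([sum_order_ideals])

      sum_{I order ideal of D} t^{number of columns meeting I}
                               (1 - t)^{number of rows meeting D \ I} = 1,

    which says that the boundary path of I, built by tossing a coin of bias t
    whenever it is free to go either up or right, ends up somewhere: the row
    sum at I is (1 - t)^{number of rows meeting K \ I}
    ([alternating_sum_fillings]).

    Prefixing the words with the letter 1 sums this over the ideals I of K that
    lie in one column.  They are the segments of a column ending at the leftmost
    box z of a row of K ([sum_one_column_ideals]), and removing one of them
    kills exactly the k_z single-box rows that it meets.  With X = 1 - t, the
    result is the sum of X^{S - k_z} over the S rows of K
    ([dual_grothendieck_alternating]), hence g determines S and the multiset of
    the k_z.  The nonzero k_z are the numbers 1, ..., b_c for each column c,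
    where b_c is its bottleneck number, and the odd numbers 2 k - 1 for
    1 <= k <= b_c add up to b_c^2 ([sum_leftmost_ranks]). *)

Set Implicit Arguments.
Unset Strict Implicit.
Unset Printing Implicit Defensive.

Import GRing.Theory.

Local Open Scope nat_scope.

(** * Order ideals in planar sets of cells *)

Section Cells.
Variables (X : finType) (m n : nat) (row : X -> 'I_m) (col : X -> 'I_n).
Implicit Types (D I K : {set X}) (x y z : X).

(** The rows and columns of a cell are only compared within one column or one
    row, as in the definition of a reverse plane partition. *)
Definition northwest y x :=
  (row y == row x) && (col y <= col x) || (col y == col x) && (row y <= row x).

Definition order_ideal D I :=
  (I \subset D) && [forall x in I, forall y in D, northwest y x ==> (y \in I)].

Definition ncol I := #|col @: I|.
Definition nrow I := #|row @: I|.

(** The form of convexity on which the identities between order ideals rest; it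
    passes to the complement of an order ideal. *)
Definition southwest_closed D := forall p q, p \in D -> q \in D ->
  row p <= row q -> col p <= col q ->
  exists z, [/\ z \in D, row z = row q & col z = col p].

(** The cells that can belong to an order ideal whose complement still meets
    every column of [D]; see [ideal_core]. *)
Definition core D :=
  [set z in D | [exists w in D, (col w == col z) && (row z < row w)]].

Lemma order_idealP D I :
  reflect [/\ {subset I <= D},
      forall x y, x \in I -> y \in D -> row y = row x -> col y <= col x ->
        y \in I &
      forall x y, x \in I -> y \in D -> col y = col x -> row y <= row x ->
        y \in I]
    (order_ideal D I).
Proof.
apply: (iffP andP) => [[sID /forall_inP h]|[sID hr hc]].
  split; first exact/subsetP.
    move=> x y xI yD e l; move/forall_inP: (h x xI) => /(_ y yD) /implyP; apply.
    by rewrite /northwest e eqxx l.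
  move=> x y xI yD e l; move/forall_inP: (h x xI) => /(_ y yD) /implyP; apply.
  by rewrite /northwest e eqxx l orbT.
split; first exact/subsetP.
apply/forall_inP => x xI; apply/forall_inP => y yD; apply/implyP.
by case/orP => /andP[/eqP e l]; [exact: (hr x)|exact: (hc x)].
Qed.

Lemma order_ideal0 D : order_ideal D set0.
Proof. by apply/order_idealP; split=> x; rewrite ?inE // => y; rewrite inE. Qed.

Lemma order_ideal_id D : order_ideal D D.
Proof. by apply/order_idealP; split. Qed.

Lemma ncol0 : ncol set0 = 0. Proof. by rewrite /ncol imset0 cards0. Qed.
Lemma nrow0 : nrow set0 = 0. Proof. by rewrite /nrow imset0 cards0. Qed.

Lemma ncol_eq0 I : (ncol I == 0) = (I == set0).
Proof. by rewrite /ncol cards_eq0 imset_eq0. Qed.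

Lemma ncolS D I : I \subset D -> ncol I <= ncol D.
Proof. by move=> s; apply/subset_leq_card/imsetS. Qed.

Lemma southwest_closedD D I :
  southwest_closed D -> order_ideal D I -> southwest_closed (D :\: I).
Proof.
move=> cD /order_idealP[_ _ hc] p q; rewrite !inE => /andP[pI pD] /andP[_ qD] rpq cpq.
have [z [zD rz cz]] := cD p q pD qD rpq cpq.
exists z; split=> //; rewrite inE zD andbT.
by apply: contra pI => zI; apply: (hc z) => //; rewrite rz.
Qed.

(** A leftmost cell of the bottom row is leftmost overall: a cell further left
    would have a southwest corner with it in that same row. *)
Lemma southwest_cell D : southwest_closed D -> D != set0 ->
  exists x, [/\ x \in D, {in D, forall y, row y <= row x} &
    {in D, forall y, col x <= col y}].
Proof.
move=> cD /set0Pn[x0 x0D].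
case: (arg_maxnP (fun y => row y : nat) x0D) => x1 x1D max1.
have x1P : (x1 \in D) && (row x1 == row x1) by apply/andP; split.
case: (@arg_minnP _ x1 (fun y => (y \in D) && (row y == row x1))
  (fun y => col y : nat) x1P) => x /andP[xD /eqP rx] minx.
exists x; split=> // y yD; first by rewrite rx; apply: max1.
have [//|lt_yx] := leqP (col x) (col y).
have le_r : row y <= row x by rewrite rx; apply: max1.
have [z [zD rz cz]] := cD y x yD xD le_r (ltnW lt_yx).
by move: lt_yx; rewrite -cz ltnNge minx // zD rz rx eqxx.
Qed.

(** Follow the boundary of [I] from the southwest end of [D].  Either the first
    step goes up and the whole bottom row is left out of [I], which costs a
    factor [1 - t], or it goes right and the whole leftmost column is put into
    [I], which costs [t].  What remains in either case is the same sum for [D]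
    without that row or column, which is 1 by induction. *)
Lemma sum_order_ideals (R : comNzRingType) (t : R) D : southwest_closed D ->
  (\sum_(I | order_ideal D I) t ^+ ncol I * (1 - t) ^+ nrow (D :\: I) = 1)%R.
Proof.
have [k] := ubnP #|D|; elim: k D => // k IHk D /ltnSE leDk cD.
have [->|D0] := eqVneq D set0.
  rewrite (big_pred1 set0) ?set0D ?ncol0 ?nrow0 ?expr0 ?mulr1 // => I.
  rewrite /=; apply/idP/eqP => [/order_idealP[s _ _]|->]; last exact: order_ideal0.
  by apply/setP => x; rewrite inE; apply/negP => /s; rewrite inE.
have [x [xD xbot xleft]] := southwest_cell cD D0.
pose B := [set y in D | row y == row x]; pose C := [set y in D | col y == col x].
have lt_card (E : {set X}) : E \subset D -> x \in E -> #|D :\: E| < k.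
  move=> sED xE; apply: leq_trans leDk; apply: proper_card.
  apply/properP; split; first exact: subsetDl.
  by exists x => //; rewrite inE xE.
have xB : x \in B by rewrite inE xD eqxx.
have xC : x \in C by rewrite inE xD eqxx.
have sBD : B \subset D by apply/subsetP => y; rewrite inE => /andP[].
have sCD : C \subset D by apply/subsetP => y; rewrite inE => /andP[].
have cDB : southwest_closed (D :\: B).
  move=> p q; rewrite !inE => /andP[pB pD] /andP[qB qD] rpq cpq.
  have [z [zD rz cz]] := cD p q pD qD rpq cpq.
  by exists z; split=> //; rewrite !inE zD rz andbT; move: qB; rewrite qD.
have cDC : southwest_closed (D :\: C).
  move=> p q; rewrite !inE => /andP[pC pD] /andP[qC qD] rpq cpq.
  have [z [zD rz cz]] := cD p q pD qD rpq cpq.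
  by exists z; split=> //; rewrite !inE zD cz andbT; move: pC; rewrite pD.
(* The southwest cell decides: without it an ideal misses its row [B], with it
   an ideal contains its column [C]. *)
rewrite (bigID (fun I : {set X} => x \in I)) /= addrC.
rewrite (eq_bigl (order_ideal (D :\: B))); last first.
  move=> I; apply/andP/order_idealP => [[/order_idealP[sI hr hc] xI]|[sI hr hc]].
    split.
    - move=> y yI; rewrite !inE sI // andbT; apply: contra xI => /= /eqP ryx.
      by apply: (hr y) => //; rewrite ?ryx // xleft // sI.
    - by move=> y z yI /setDP[zD _]; apply: hr.
    - by move=> y z yI /setDP[zD _]; apply: hc.
  have notB y : y \in I -> row y != row x.
    by move=> /sI; rewrite !inE => /andP[+ yD]; rewrite yD.
  split; last by apply/negP => /notB; rewrite eqxx.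
  apply/order_idealP; split.
  - by move=> y /sI /setDP[].
  - by move=> y z yI zD e l; apply: (hr y) => //; rewrite !inE zD e notB.
  - move=> y z yI zD e l; apply: (hc y) => //; rewrite !inE zD /= andbT.
    apply/eqP => rz; have := notB _ yI; rewrite -(inj_eq val_inj) /= eqn_leq.
    by case/setDP: (sI _ yI) => /xbot-> _; rewrite -rz l.
have -> : (\sum_(I | order_ideal (D :\: B) I) t ^+ ncol I * (1 - t) ^+ nrow (D :\: I)
   = 1 - t)%R.
  rewrite -[RHS]mulr1 -[X in _ = (_ * X)%R](IHk _ (lt_card _ sBD xB) cDB) mulr_sumr.
  apply: eq_bigr => I /order_idealP[sI _ _]; rewrite [in RHS]mulrCA -exprS.
  congr (_ * _ ^+ _)%R.
  have rDI : row @: (D :\: I) = row x |: row @: ((D :\: B) :\: I).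
    apply/setP => r; rewrite in_setU1; apply/imsetP/orP.
      move=> [y /setDP[yD yI] ->]; have [->|ne] := eqVneq (row y) (row x); first by left.
      by right; apply: imset_f; rewrite !inE yI yD ne.
    case=> [/eqP ->|/imsetP[y]].
      exists x => //; rewrite inE xD andbT; apply/negP => /sI.
      by rewrite !inE xD eqxx.
    by rewrite !inE => /and3P[yI _ yD] ->; exists y => //; rewrite inE yI.
  rewrite /nrow rDI cardsU1; case: imsetP => // -[y]; rewrite !inE => /and3P[_ + yD] e.
  by rewrite yD e eqxx.
suff -> : (\sum_(I | order_ideal D I && (x \in I)) t ^+ ncol I * (1 - t) ^+ nrow (D :\: I)
   = t)%R by rewrite subrK.
rewrite -[RHS]mulr1 -[X in _ = (_ * X)%R](IHk _ (lt_card _ sCD xC) cDC) mulr_sumr.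
rewrite (reindex_onto (fun J => C :|: J) (fun I => I :\: C)) /=; last first.
  move=> I /andP[/order_idealP[sI hr hc] xI].
  apply/setP => y; rewrite !inE; case yD: (y \in D) => //=.
  have [e|//] := eqVneq (col y) (col x); rewrite /=.
  by apply/esym; apply: (hc x) => //; apply: xbot.
apply: eq_big => [J|J].
  apply/idP/order_idealP.
    case/andP => /andP[/order_idealP[sI hr hc] _] /eqP eJ.
    have JP y : (y \in J) = (y \notin C) && (y \in C :|: J) by rewrite -{1}eJ inE.
    split.
    - by move=> y; rewrite JP => /andP[yC /sI yD]; rewrite inE yC.
    - move=> y z; rewrite !JP => /andP[yC yI] /setDP[zD zC] e l; rewrite zC /=.
      exact: (hr y).
    - move=> y z; rewrite !JP => /andP[yC yI] /setDP[zD zC] e l; rewrite zC /=.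
      exact: (hc y).
  move=> [sJ hr hc].
  have notC y : y \in J -> y \notin C by move/sJ/setDP => [].
  rewrite inE xC /= andbT; apply/andP; split; last first.
    apply/eqP/setP => y; rewrite inE in_setU.
    by case yC: (y \in C) => //=; apply/esym/negP => /notC; rewrite yC.
  apply/order_idealP; split.
  - by move=> y /setUP[/(subsetP sCD)|/sJ/setDP[]].
  - move=> y z yI zD e l; rewrite in_setU; have [//|zC /=] := boolP (z \in C).
    case/setUP: yI => [|yJ]; last by apply: (hr y) => //; rewrite inE zC.
    rewrite inE => /andP[yD /eqP cy]; move: zC; rewrite inE zD /= => /negP[].
    by rewrite -(inj_eq val_inj) eqn_leq xleft // andbT -cy l.
  - move=> y z yI zD e l; rewrite in_setU; have [//|zC /=] := boolP (z \in C).
    case/setUP: yI => [|yJ]; last by apply: (hc y) => //; rewrite inE zC.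
    by rewrite inE => /andP[yD /eqP cy]; move: zC; rewrite inE zD /= e cy eqxx.
move=> /andP[/andP[/order_idealP[sU _ _] _] /eqP eJ]; rewrite mulrA -exprS setDDl.
congr (_ ^+ _ * _)%R.
have cU : col @: (C :|: J) = col x |: col @: J.
  rewrite imsetU; congr (_ :|: _); apply/setP => c; rewrite inE; apply/imsetP/eqP.
    by move=> [y]; rewrite inE => /andP[_ /eqP] <-.
  by move=> ->; exists x.
rewrite /ncol cU cardsU1; case: imsetP => // -[y].
move=> yJ e; have /sU yD : y \in C :|: J by rewrite inE yJ orbT.
by move: yJ; rewrite -eJ !inE yD e eqxx.
Qed.

Lemma coreP D z :
  reflect (z \in D /\ exists w, [/\ w \in D, col w = col z & row z < row w])
    (z \in core D).
Proof.
rewrite inE; apply: (iffP andP) => [[zD /exists_inP[w wD /andP[/eqP cw lt]]]|].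
  by split=> //; exists w.
move=> [zD [w [wD cw lt]]]; split=> //; apply/exists_inP; exists w => //.
by rewrite cw eqxx.
Qed.

Lemma core_sub D : {subset core D <= D}.
Proof. by move=> z /coreP[]. Qed.

Lemma core_ideal D : southwest_closed D -> order_ideal D (core D).
Proof.
move=> cD; apply/order_idealP; split; first exact: core_sub.
  move=> x y /coreP[xD [w [wD cw lt]]] yD e l.
  apply/coreP; split=> //.
  have [||z [zD rz cz]] := cD y w yD wD; [by rewrite e ltnW|by rewrite cw|].
  by exists z; split=> //; rewrite rz e.
move=> x y /coreP[xD [w [wD cw lt]]] yD e l; apply/coreP; split=> //.
by exists w; split=> //; rewrite ?e //; apply: leq_ltn_trans lt.
Qed.

Lemma southwest_closed_core D : southwest_closed D -> southwest_closed (core D).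
Proof.
move=> cD p q pK qK rpq cpq.
have pD := core_sub pK; have /coreP[qD [w [wD cw lt]]] := qK.
have [z [zD rz cz]] := cD p q pD qD rpq cpq; exists z; split=> //.
apply/coreP; split=> //.
have [||v [vD rv cv]] := cD p w pD wD; [exact: leq_trans rpq (ltnW lt)|by rewrite cw|].
by exists v; split; rewrite ?rv ?cv ?cz ?rz.
Qed.

(** An order ideal is an initial segment of each column, so it leaves every
    column nonempty iff it misses the bottom cell of each. *)
Lemma ideal_core D I : southwest_closed D ->
  order_ideal (core D) I = order_ideal D I && (ncol (D :\: I) == ncol D).
Proof.
move=> cD; have /order_idealP[_ kr kc] := core_ideal cD.
apply/idP/andP => [/order_idealP[sI hr hc]|[iI /eqP eqn]].
  have iI : order_ideal D I.
    apply/order_idealP; split=> [y /sI/core_sub//|x y xI yD e l|x y xI yD e l].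
      by apply: (hr x) => //; apply: (kr x) => //; apply: sI.
    by apply: (hc x) => //; apply: (kc x) => //; apply: sI.
  split=> //; rewrite /ncol; apply/eqP/eq_card/subset_eqP/andP; split.
    exact/imsetS/subsetDl.
  apply/subsetP => _ /imsetP[z zD ->].
  have zP : (z \in D) && (col z == col z) by apply/andP.
  have [w /andP[wD /eqP cw] maxw] :=
    @arg_maxnP _ z (fun y => (y \in D) && (col y == col z)) (fun y => row y : nat) zP.
  rewrite -cw; apply: imset_f; rewrite inE wD andbT.
  apply/negP => /sI/coreP[_ [v [vD cv]]]; rewrite ltnNge => /negP[].
  by apply: maxw; rewrite vD cv cw eqxx.
have /order_idealP[sI hr hc] := iI.
have eqc : col @: (D :\: I) = col @: D.
  by apply/eqP; rewrite eqEcard imsetS ?subsetDl //=; apply: eq_leq (esym eqn).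
have sIK : {subset I <= core D}.
  move=> z zI; have zD := sI _ zI; apply/coreP; split=> //.
  have: col z \in col @: (D :\: I) by rewrite eqc imset_f.
  move=> /imsetP[w /setDP[wD wI] cw]; exists w; split=> //.
  by rewrite ltnNge; apply: contra wI => le; apply: (hc z).
apply/order_idealP; split=> // x y xI /core_sub yD; [exact: hr|exact: hc].
Qed.

Lemma coreD D I : order_ideal D I -> core (D :\: I) = core D :\: I.
Proof.
move=> /order_idealP[sI hr hc]; apply/setP => z; apply/coreP/setDP.
  move=> [/setDP[zD zI] [w [/setDP[wD _] cw lt]]]; split=> //.
  by apply/coreP; split=> //; exists w.
move=> [/coreP[zD [w [wD cw lt]]] zI]; split; first by rewrite inE zI.
exists w; split=> //; rewrite inE wD andbT; apply: contra zI => wI.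
by apply: (hc w) => //; rewrite ?cw // ltnW.
Qed.

(** * Counting chains of order ideals *)

(** The fillings of [D], weakly increasing along rows and columns, in which the
    i-th letter occupies [nth 0 a i] columns, counted layer by layer. *)
Fixpoint num_fillings (a : seq nat) D : nat :=
  if a is k :: a' then
    \sum_(I | order_ideal D I && (ncol I == k)) num_fillings a' (D :\: I)
  else D == set0.

Lemma num_fillings1 k D : num_fillings [:: k] D = (ncol D == k).
Proof.
rewrite /= big_mkcond (bigD1 D) //= order_ideal_id setDv eqxx big1 ?addn0.
  by case: eqP.
move=> I ne; case: ifP => // /andP[/order_idealP[sI _ _] _].
rewrite -[X in nat_of_bool X]/(_ == _); case: eqP => // e; case/eqP: ne.
by apply/eqP; rewrite eqEsubset -(setD_eq0 D) e eqxx andbT; apply/subsetP.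
Qed.

Section Alternating.
Variables (R : comNzRingType) (t : R).

(** The words of length [l] in the letters 1, ..., [M].  The bounds [M] on the
    letters and [N] on the lengths below only serve to have finite sums. *)
Fixpoint words (M l : nat) : seq (seq nat) :=
  if l is l'.+1 then [seq k :: a | k <- iota 1 M, a <- words M l']
  else [:: [::]].

Definition alternating_sum (M N : nat) (G : seq nat -> R) : R :=
  (\sum_(l < N) \sum_(a <- words M l) (\prod_(k <- a) - t ^+ k) * G a)%R.

(** Splitting off the first letter is the recursion
    U^{-1} = 1 - (U - 1) U^{-1}. *)
Lemma alternating_sumS M N G :
  (alternating_sum M N.+1 G =
   G [::] -
   \sum_(k <- iota 1 M) t ^+ k * alternating_sum M N (fun a => G (k :: a)))%R.
Proof.
rewrite /alternating_sum big_ord_recl /= big_seq1 big_nil mul1r; congr (_ + _)%R.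
rewrite -sumrN.
under eq_bigr => i _ do rewrite big_allpairs_dep.
rewrite exchange_big; apply: eq_bigr => k _; rewrite -mulNr mulr_sumr.
apply: eq_bigr => l _; rewrite mulr_sumr; apply: eq_bigr => a _.
by rewrite big_cons mulrA.
Qed.

Lemma eq_alternating_sum M N G G' :
  G =1 G' -> alternating_sum M N G = alternating_sum M N G'.
Proof.
by move=> e; apply: eq_bigr => l _; apply: eq_bigr => a _; rewrite e.
Qed.

Lemma alternating_sum_sum M N (J : finType) (P : pred J) (F : J -> seq nat -> R) :
  (alternating_sum M N (fun a => \sum_(j | P j) F j a) =
   \sum_(j | P j) alternating_sum M N (F j))%R.
Proof.
rewrite /alternating_sum [RHS]exchange_big; apply: eq_bigr => l _.
by rewrite [RHS]exchange_big; apply: eq_bigr => a _; rewrite mulr_sumr.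
Qed.

(** The recursion of [alternating_sumS] expresses the value at [D] by the values
    at [D :\: I] for nonempty order ideals [I].  The claimed values satisfy the
    same recursion, because it amounts to [sum_order_ideals] for [core D]: the
    last letter [d] kills the ideals not contained in the core. *)
Lemma alternating_sum_fillings M N D d : southwest_closed D -> #|D| < N -> n <= M ->
  ncol D <= d ->
  (alternating_sum M N (fun a => (num_fillings (rcons a d) D)%:R) =
   if ncol D == d then (1 - t) ^+ nrow (core D) else 0)%R.
Proof.
elim: N D => // N IHN D cD ltDN leM leD.
rewrite alternating_sumS [in X in (X - _)%R]/rcons num_fillings1.
have step k : k \in iota 1 M ->
  (t ^+ k * alternating_sum M N (fun a => (num_fillings (rcons (k :: a) d) D)%:R) =
   \sum_(I | [&& order_ideal D I, I != set0 & ncol I == k])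
      t ^+ ncol I * if ncol (D :\: I) == d then (1 - t) ^+ nrow (core (D :\: I))
                   else 0)%R.
  rewrite mem_iota => /andP[k0 _].
  under eq_alternating_sum => a do rewrite rcons_cons /= natr_sum.
  rewrite alternating_sum_sum mulr_sumr; apply: eq_big => [I|I /andP[iI /eqP eI]].
    case: eqP => [e|]; rewrite ?andbF ?andbT // -ncol_eq0 e.
    by rewrite -lt0n k0 andbT.
  have s : I \subset D by apply/subsetP; case/order_idealP: iI.
  rewrite eI IHN //.
  - exact: southwest_closedD.
  - rewrite -ltnS; apply: leq_trans ltDN; rewrite ltnS; apply: proper_card.
    apply/properP; split; first exact: subsetDl.
    have /set0Pn[x xI] : I != set0 by rewrite -ncol_eq0 eI -lt0n.
    by exists x; [exact: (subsetP s)|rewrite inE xI].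
  - by apply: leq_trans leD; apply/ncolS/subsetDl.
rewrite (eq_big_seq _ step) {step}.
have -> : (\sum_(k <- iota 1 M) \sum_(I | [&& order_ideal D I, I != set0 & ncol I == k])
      t ^+ ncol I *
      (if ncol (D :\: I) == d then (1 - t) ^+ nrow (core (D :\: I)) else 0)
   = \sum_(I | order_ideal D I && (I != set0))
      t ^+ ncol I *
      (if ncol (D :\: I) == d then (1 - t) ^+ nrow (core (D :\: I)) else 0))%R.
  under eq_bigr => k _ do under eq_bigl => I do rewrite andbA.
  under eq_bigr => k _ do rewrite big_mkcondr /=.
  rewrite exchange_big; apply: eq_bigr => I /andP[_ I0].
  rewrite (bigD1_seq (ncol I)) ?iota_uniq //=.
    by rewrite eqxx big1 ?addr0 // => k; rewrite eq_sym => /negPf->.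
  rewrite mem_iota lt0n ncol_eq0 I0 add1n ltnS; apply: leq_trans leM.
  by rewrite -[n in _ <= n]card_ord max_card.
have [eD|neD] := eqVneq (ncol D) d; last first.
  rewrite big1 ?subr0 // => I _; case: eqP => [e|]; rewrite ?mulr0 //.
  by case/eqP: neD; apply/eqP; rewrite eqn_leq leD -e ncolS ?subsetDl.
have := sum_order_ideals t (southwest_closed_core cD).
rewrite (bigD1 set0) ?order_ideal0 //= ncol0 setD0 mul1r => sum1.
apply/eqP; rewrite subr_eq -[X in X == _]sum1; apply/eqP; congr (_ + _)%R.
rewrite (big_mkcond (fun I => order_ideal D I && _)) [LHS]big_mkcond; apply: eq_bigr => I _ /=.
rewrite ideal_core // -eD; case: ifP => [/andP[/andP[iI ->] ->]|].
  by rewrite iI /= coreD.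
by case: (order_ideal D I) => //=; case: eqP => //= _; case: ifP => //; rewrite mulr0.
Qed.


(** The first letter 1 peels off an order ideal meeting a single column. *)
Lemma alternating_sum_one_column M N D : southwest_closed D -> #|D| < N -> n <= M ->
  (alternating_sum M N (fun a => (num_fillings (1 :: rcons a (ncol D)) D)%:R) =
   \sum_(I | order_ideal (core D) I && (ncol I == 1))
      (1 - t) ^+ nrow (core D :\: I))%R.
Proof.
move=> cD ltDN leM.
under eq_alternating_sum => a do rewrite /= natr_sum.
rewrite alternating_sum_sum [LHS]big_mkcond [RHS]big_mkcond; apply: eq_bigr => I _ /=.
rewrite ideal_core //; have [iI|//] := boolP (order_ideal D I); rewrite /=.
rewrite [RHS](_ : _ = if ncol I == 1 then if ncol (D :\: I) == ncol D then
  (1 - t) ^+ nrow (core D :\: I) else 0 else 0)%R; last first.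
  by case: (ncol I == 1); rewrite ?andbF ?andbT.
case: ifP => // _; rewrite alternating_sum_fillings ?coreD //.
- exact: southwest_closedD.
- by apply: leq_ltn_trans ltDN; apply/subset_leq_card/subsetDl.
- by apply/ncolS/subsetDl.
Qed.

End Alternating.

(** * Order ideals in one column *)

Section Leftmost.
Hypothesis cell_inj : forall x y, row x = row y -> col x = col y -> x = y.

(** One cell for each nonempty row of [K]. *)
Definition leftmost K : {set X} :=
  [set z in K | [forall y in K, (row y == row z) ==> (col z <= col y)]].
Definition column_upto K z : {set X} :=
  [set y in K | (col y == col z) && (row y <= row z)].
Definition row_singletons K : {set X} :=
  [set z in K | [forall y in K, (row y == row z) ==> (y == z)]].

Lemma leftmostP K z :
  reflect (z \in K /\ forall y, y \in K -> row y = row z -> col z <= col y)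
    (z \in leftmost K).
Proof.
rewrite inE; apply: (iffP andP) => [[zK /forall_inP h]|[zK h]]; split=> //.
  by move=> y yK e; apply: (implyP (h y yK)); rewrite e.
by apply/forall_inP => y yK; apply/implyP => /eqP; apply: h.
Qed.

Lemma row_singletonsP K z :
  reflect (z \in K /\ forall y, y \in K -> row y = row z -> y = z)
    (z \in row_singletons K).
Proof.
rewrite inE; apply: (iffP andP) => [[zK /forall_inP h]|[zK h]]; split=> //.
  by move=> y yK e; apply/eqP/(implyP (h y yK)); rewrite e.
by apply/forall_inP => y yK; apply/implyP => /eqP e; apply/eqP/h.
Qed.

(** An order ideal meeting a single column is determined by its lowest cell,
    which must be leftmost in its row.  Conversely a cell above a leftmost cell
    is leftmost too, since otherwise a southwest corner would lie to the left of
    the lower one. *)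
Lemma sum_one_column_ideals (R : nmodType) (F : {set X} -> R) K : southwest_closed K ->
  (\sum_(I | order_ideal K I && (ncol I == 1)) F I =
   \sum_(z in leftmost K) F (column_upto K z))%R.
Proof.
move=> cK.
have inj : {in leftmost K &, injective (column_upto K)}.
  move=> z z' /leftmostP[zK _] /leftmostP[zK' _] e.
  have: z \in column_upto K z' by rewrite -e inE zK eqxx leqnn.
  have: z' \in column_upto K z by rewrite e inE zK' eqxx leqnn.
  rewrite !inE => /andP[_ /andP[/eqP ec le1]] /andP[_ /andP[_ le2]].
  by apply: cell_inj => //; apply: val_inj; apply/eqP; rewrite eqn_leq le1 le2.
rewrite -(big_imset _ inj) /=; apply: eq_bigl => I; apply/andP/imsetP.
  move=> [/order_idealP[sI hr hc] /cards1P[c eI]].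
  have colI y : y \in I -> col y = c.
    by move=> yI; apply/set1P; rewrite -eI imset_f.
  have: c \in col @: I by rewrite eI inE.
  case/imsetP => x0 x0I _.
  have [z zI maxz] := @arg_maxnP _ x0 (mem I) (fun y => row y : nat) x0I.
  exists z; first apply/leftmostP; last apply/setP => y.
    split; first exact: sI.
    move=> y yK e; have [//|lt] := leqP (col z) (col y).
    have yI : y \in I by apply: (hr z) => //; apply: ltnW.
    by move: lt; rewrite (colI _ yI) (colI _ zI) ltnn.
  rewrite inE; apply/idP/andP => [yI|[yK /andP[/eqP ec le]]]; last exact: (hc z).
  by rewrite sI // (colI _ yI) (colI _ zI) eqxx; split=> //; apply: maxz.
move=> [z /leftmostP[zK hz] ->]; split.
  apply/order_idealP; split=> [y|x y|x y]; rewrite !inE; first by case/andP.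
    move=> /andP[xK /andP[/eqP cx le]] yK e l; rewrite yK e le andbT /=.
    apply/eqP/val_inj/eqP; rewrite eqn_leq -cx l /=.
    have [||v [vK rv cv]] := cK y z yK zK; [by rewrite e|by rewrite -cx|].
    by rewrite -cv cx hz.
  move=> /andP[xK /andP[/eqP cx le]] yK e l.
  by rewrite yK e cx eqxx (leq_trans l le).
rewrite /ncol (_ : col @: _ = [set col z]) ?cards1 //.
apply/setP => c; rewrite inE; apply/imsetP/eqP => [[y]|->].
  by rewrite inE => /andP[_ /andP[/eqP-> _]].
by exists z; rewrite // inE zK eqxx leqnn.
Qed.

Lemma card_leftmost K : #|leftmost K| = nrow K.
Proof.
rewrite /nrow -(@card_in_imset _ _ row (leftmost K)); last first.
  move=> x y /leftmostP[xK hx] /leftmostP[yK hy] e; apply: cell_inj => //.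
  by apply: val_inj; apply/eqP; rewrite eqn_leq hx ?hy.
apply: eq_card => r; apply/imsetP/imsetP => [[z /leftmostP[zK _] ->]|[z zK ->]].
  by exists z.
have zP : (z \in K) && (row z == row z) by apply/andP.
have [w /andP[wK /eqP ew] minw] :=
  @arg_minnP _ z (fun y => (y \in K) && (row y == row z)) (fun y => col y : nat) zP.
exists w => //; apply/leftmostP; split=> // y yK e; apply: minw.
by rewrite yK e ew /=.
Qed.

(** A row disappears with the segment iff its only cell lies in it. *)
Lemma nrow_column_upto K z :
  nrow (K :\: column_upto K z) + #|row_singletons K :&: column_upto K z| = nrow K.
Proof.
set B := _ :&: _; have -> : #|B| = #|row @: B|.
  apply/esym/card_in_imset => x y /setIP[/row_singletonsP[xK hx] _].
  by move=> /setIP[/row_singletonsP[yK hy] _] e; apply: hy.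
have I0 : row @: (K :\: column_upto K z) :&: row @: B = set0.
  apply/setP => r; rewrite !inE; apply/negP => /andP[/imsetP[x /setDP[xK xC] ->]].
  move=> /imsetP[y /setIP[/row_singletonsP[yK hy] yC] e].
  by move: xC; rewrite (hy x) ?yC.
rewrite /nrow -cardsUI I0 cards0 addn0.
congr #|pred_of_set _|; rewrite -imsetU; apply/setP => r; apply/imsetP/imsetP.
  move=> [x xU ->]; exists x => //.
  by case/setUP: xU => [/setDP[]//|/setIP[/row_singletonsP[]]].
move=> [x xK ->]; have [xC|xC] := boolP (x \in column_upto K z); last first.
  by exists x => //; rewrite in_setU inE xC xK.
have [xB|] := boolP (x \in row_singletons K).
  by exists x => //; rewrite in_setU in_setI xB xC orbT.
rewrite inE xK /= negb_forall_in => /exists_inP[y yK]; rewrite negb_imply => /andP[/eqP e ne].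
exists y => //; rewrite in_setU inE yK andbT; apply/orP; left.
apply: contra ne => yC; apply/eqP/cell_inj => //.
move: xC yC; rewrite !inE => /andP[_ /andP[/eqP-> _]].
by case/andP => _ /andP[/eqP].
Qed.

(** The ranks are 1, ..., #|B|.  Comparing each pair of cells both ways gives
    their sum without ordering [B]: only the diagonal is counted twice. *)
Lemma sum_ranks (B : {set X}) : {in B &, injective row} ->
  2 * (\sum_(z in B) #|[set y in B | row y <= row z]|) = #|B| ^ 2 + #|B|.
Proof.
move=> inj.
have eS : \sum_(z in B) #|[set y in B | row y <= row z]| =
  \sum_(z in B) \sum_(y in B) (row y <= row z).
  apply: eq_bigr => z _; rewrite -sum1_card big_mkcond [RHS]big_mkcond.
  by apply: eq_bigr => y _; rewrite inE; case: (y \in B).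
rewrite mul2n -addnn {1}eS eS [X in X + _ = _]exchange_big -big_split /=.
rewrite (eq_bigr (fun=> #|B| + 1)) => [|z zB].
  by rewrite sum_nat_const mulnDr muln1 -mulnn.
rewrite -big_split /= (eq_bigr (fun y => 1 + (y == z))) => [|y yB].
  rewrite big_split /= sum1_card (bigD1 z) //= eqxx big1 ?addn0 //.
  by move=> y /andP[_ /negPf->].
have [->|ne] := eqVneq y z; first by rewrite leqnn.
have: row y != row z :> nat.
  by apply: contra ne => /eqP e; apply/eqP/inj => //; apply: val_inj.
by case: ltngtP.
Qed.

Definition northeast_closed K := forall p q, p \in K -> q \in K ->
  row p <= row q -> col p <= col q ->
  exists z, [/\ z \in K, row z = row p & col z = col q].

(** A leftmost cell that is not alone in its row contributes 0, as the truncated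
    [2 * 0 - 1]: a single-cell row above it in the same column would also have to
    contain the northeast corner with another cell of its row.  In each column
    the remaining terms are the first odd numbers, whose sum is a square. *)
Lemma sum_leftmost_ranks K : northeast_closed K ->
  \sum_(z in leftmost K) (2 * #|row_singletons K :&: column_upto K z| - 1) =
  \sum_(c < n) #|[set z in row_singletons K | col z == c]| ^ 2.
Proof.
move=> nK.
rewrite (bigID (mem (row_singletons K))) /= [X in _ + X]big1 ?addn0; last first.
  move=> z /andP[/leftmostP[zK hz]]; rewrite inE zK /= negb_forall_in.
  move=> /exists_inP[w wK]; rewrite negb_imply => /andP[/eqP e ne].
  rewrite (_ : _ :&: _ = set0) ?cards0 //; apply/setP => y; rewrite in_setI in_set0.
  apply/negP => /andP[/row_singletonsP[yK hy]]; rewrite inE yK /= => /andP[/eqP cy le].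
  have [||v [vK rv cv]] := nK y w yK wK; [by rewrite e|by rewrite cy hz|].
  have ev := hy v vK rv; case/eqP: ne; apply: cell_inj => //.
  by rewrite -cv ev.
rewrite (eq_bigl (mem (row_singletons K))); last first.
  move=> z /=; apply: andb_idl => /row_singletonsP[zK hz]; apply/leftmostP.
  by split=> // y yK e; rewrite (hz y).
rewrite (partition_big col predT) //=; apply: eq_bigr => c _.
set B := [set z in _ | _].
have inB y : (y \in B) = (y \in row_singletons K) && (col y == c) by rewrite in_set.
have injB : {in B &, injective row}.
  move=> x y; rewrite !inB => /andP[/row_singletonsP[xK _] _].
  by move=> /andP[/row_singletonsP[yK hy] _] e; apply: hy.
apply/eqP; rewrite -(eqn_add2r #|B|) -sum_ranks //; apply/eqP.
rewrite -[in X in _ + X]sum1_card big_distrr /=.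
under eq_bigl => z do rewrite -inB.
rewrite -big_split /=; apply: eq_bigr => z zB.
have /andP[zS /eqP zc] : (z \in row_singletons K) && (col z == c) by rewrite -inB.
have -> : row_singletons K :&: column_upto K z = [set y in B | row y <= row z].
  apply/setP => y; rewrite in_setI [RHS]in_set inB [y \in column_upto _ _]in_set zc -andbA.
  by case: (boolP (y \in row_singletons K)) => [/row_singletonsP[-> _]|].
rewrite subnK // muln_gt0 /= card_gt0; apply/set0Pn; exists z.
by rewrite in_set zB leqnn.
Qed.

End Leftmost.
Implicit Types (P : {ffun X -> nat}).

(** * Fillings as explicit lists *)

Definition add_layer j I P : {ffun X -> nat} :=
  [ffun x => if x \in I then j else P x].

(** Letters start at [j], and cells outside [D] get the value 0, so that for
    [0 < j] the layers can be read off the function. *)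
Fixpoint fillings (a : seq nat) (j : nat) D : seq {ffun X -> nat} :=
  if a is k :: a' then
    [seq add_layer j J P | J <- enum [pred J | order_ideal D J && (ncol J == k)],
                           P <- fillings a' j.+1 (D :\: J)]
  else if D == set0 then [:: [ffun=> 0]] else [::].

Definition is_filling (a : seq nat) j D P :=
  [/\ forall x, x \notin D -> P x = 0,
      forall x, x \in D -> j <= P x < j + size a,
      {in D &, forall x y, northwest x y -> P x <= P y} &
      forall i, i < size a -> ncol [set x in D | P x == j + i] = nth 0 a i].

Lemma size_fillings a j D : size (fillings a j D) = num_fillings a D.
Proof.
elim: a j D => [|k a IHa] j D /=; first by case: ifP.
rewrite size_allpairs_dep sumnE big_map big_enum_cond /=.
by apply: eq_big => // I; rewrite ?andbT.
Qed.

Lemma add_layer_filling k a j D I P : 0 < j -> order_ideal D I -> ncol I = k ->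
  is_filling a j.+1 (D :\: I) P -> is_filling (k :: a) j D (add_layer j I P).
Proof.
move=> j0 /order_idealP[sI hr hc] nI [out bnd mono cols].
have PI x : x \notin I -> P x == j = false.
  move=> xI; have [xD|xD] := boolP (x \in D); last first.
    by rewrite out ?inE ?(negPf xD) ?andbF // eq_sym -leqn0 leqNgt j0.
  have /andP[lt _] := bnd x (introT setDP (conj xD xI)).
  by rewrite eq_sym ltn_eqF.
split.
- move=> x xD; rewrite ffunE; case: ifP => [/sI|]; first by rewrite (negPf xD).
  by move=> _; apply: out; rewrite inE (negPf xD) andbF.
- move=> x xD; rewrite ffunE; case: ifP => xI; first by rewrite leqnn /= addnS ltnS leq_addr.
  have /andP[lt1 lt2] : j.+1 <= P x < j.+1 + size a by apply: bnd; rewrite inE xI.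
  by rewrite ltnW //= addnS -addSn.
- move=> x y xD yD nw; rewrite !ffunE; case: ifP => xI; case: ifP => yI //.
  + have /andP[lt1 lt2] : j.+1 <= P y < j.+1 + size a by apply: bnd; rewrite inE yI.
    exact: ltnW.
  + move: xI; case/orP: nw => /andP[/eqP e l]; first by rewrite (hr y x).
    by rewrite (hc y x).
  + by apply: mono => //; rewrite inE ?xI ?yI.
move=> [|i] /=.
  rewrite addn0 => _; rewrite -nI; congr (ncol _).
  apply/setP => x; rewrite inE ffunE; case: (boolP (x \in I)) => [/sI->|xI]; rewrite ?eqxx //.
  by rewrite PI // andbF.
rewrite ltnS => lt; rewrite -cols //; congr (ncol _).
apply/setP => x; rewrite !inE ffunE addnS -addSn; case: (boolP (x \in I)) => //= xI.
by rewrite ltn_eqF ?andbF // ltn_addr.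
Qed.

Lemma is_fillingP a j D P : 0 < j -> reflect (is_filling a j D P) (P \in fillings a j D).
Proof.
move=> j0; apply: (iffP idP); elim: a j j0 D P => [|k a IHa] j j0 D P /=.
- case: ifP => // /eqP->; rewrite inE => /eqP->.
  by split=> //= x; rewrite ?inE // => _; rewrite ffunE.
- move=> /allpairsPdep[I [P' [Ie P'e ->]]]; move: Ie; rewrite mem_enum inE => /andP[iI /eqP eI].
  by apply: add_layer_filling => //; apply: IHa.
- move=> [out bnd _ _].
  have D0 x : x \notin D by apply/negP => /bnd /andP[le]; rewrite addn0 ltnNge le.
  have -> : D = set0 by apply/setP => x; rewrite inE (negPf (D0 x)).
  by rewrite eqxx inE; apply/eqP/ffunP => x; rewrite ffunE out.
move=> [out bnd mono cols]; pose I := [set x in D | P x == j].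
have sI : {subset I <= D} by move=> x; rewrite inE => /andP[].
have PI x : x \in I -> P x = j by rewrite inE => /andP[_ /eqP].
apply/allpairsPdep; exists I, [ffun x => if x \in I then 0 else P x].
have iI : order_ideal D I.
  have key x y : x \in I -> y \in D -> northwest y x -> y \in I.
    move=> xI yD nw; have : P y <= P x by apply: mono => //; apply: sI.
    by rewrite (PI x xI) inE yD eqn_leq => -> /=; case/andP: (bnd y yD).
  apply/order_idealP; split=> // x y xI yD e l; apply: (key x) => //.
    by rewrite /northwest e l eqxx.
  by rewrite /northwest e l eqxx orbT.
split.
- by rewrite mem_enum inE iI /=; apply/eqP; have /= := cols 0 isT; rewrite addn0.
- apply: IHa => //; split.
  + move=> x xD; rewrite ffunE; case: ifP => // xI; apply: out.
    by apply: contra xD => xD; rewrite inE xI.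
  + move=> x /setDP[xD xI]; rewrite ffunE (negPf xI).
    have /andP[le lt] := bnd x xD; rewrite addSn -addnS lt andbT.
    by rewrite ltn_neqAle le andbT; move: xI; rewrite inE xD eq_sym.
  + move=> x y /setDP[xD xI] /setDP[yD yI] nw; rewrite !ffunE (negPf xI) (negPf yI).
    exact: mono.
  + move=> i lt; have /= <- := cols i.+1 lt; congr (ncol _).
    apply/setP => x; rewrite in_set in_setD ffunE addSn -addnS [RHS]in_set.
    have [xI|xI] := boolP (x \in I); last by case: (x \in D).
    by rewrite (PI x xI) -[X in _ = _ && (X == _)]addn0 eqn_add2l andbF.
- apply/ffunP => x; by rewrite !ffunE; case: (boolP (x \in I)) => [/PI|].
Qed.

Lemma fillings_uniq a j D : 0 < j -> uniq (fillings a j D).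
Proof.
elim: a j D => [|k a IHa] j D j0 /=; first by case: ifP.
apply: allpairs_uniq_dep; first exact: enum_uniq.
  by move=> I _; apply: IHa.
move=> u v /allpairsPdep[I [P [_ PF ->]]] /allpairsPdep[I' [P' [_ PF' ->]]] /= e.
have lay J (Q : {ffun X -> nat}) : Q \in fillings a j.+1 (D :\: J) ->
    forall x, (add_layer j J Q x == j) = (x \in J).
  move=> /is_fillingP QF x; rewrite ffunE.
    case: (boolP (x \in J)) => [_|xJ]; first exact: eqxx.
    case: (QF isT) => out bnd _ _.
    have [xD|/out->] := boolP (x \in D :\: J); last by case: (j) j0.
  by have /andP[lt _] := bnd x xD; rewrite eq_sym ltn_eqF.
have eI : I = I' by apply/setP => x; rewrite -(lay _ _ PF) e lay.
move: PF' e; rewrite -eI => PF' e; congr existT; apply/ffunP => x.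
move/ffunP/(_ x): e; rewrite !ffunE; case: ifP => // xI _.
have xD : x \notin D :\: I by rewrite inE xI.
by case/is_fillingP: PF => // ->; case/is_fillingP: PF' => // ->.
Qed.

End Cells.

(** The exponents are a multiset, recovered from the coefficients of the
    polynomial. *)
Lemma eq_sum_exponents (S T : finType) (A : {set S}) (B : {set T})
    (e : S -> nat) (f : T -> nat) :
  (\sum_(x in A) 'X^(e x) = \sum_(y in B) 'X^(f y) :> {poly int})%R ->
  forall h : nat -> nat, \sum_(x in A) h (e x) = \sum_(y in B) h (f y).
Proof.
move=> eqp h.
have cnt (U : finType) (C : {set U}) (g : U -> nat) j :
    ((\sum_(x in C) 'X^(g x) : {poly int})`_j = (count_mem j [seq g x | x in C])%:R)%R.
  rewrite coef_sum -sum1_count [X in (X%:R)%R]big_mkcond big_image natr_sum.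
  by apply: eq_bigr => x _; rewrite coefXn eq_sym /=; case: eqP.
have p : perm_eq [seq e x | x in A] [seq f y | y in B].
  apply/allP => j _ /=; rewrite -(Num.Theory.eqr_nat int) -!cnt eqp; exact: eqxx.
transitivity (\sum_(j <- [seq e x | x in A]) h j); first by rewrite big_image.
by rewrite (perm_big _ p) big_image.
Qed.

(** * Coefficients of the dual stable Grothendieck polynomial *)

(** The letter at position [i] is the exponent of the variable of index [i + 1],
    as the entries of a reverse plane partition are positive. *)
Definition word_monomial (a : seq nat) : {cmonom nat} :=
  [cmonom nth 0 a i.-1 | i in [fset i in iota 1 (size a)]%fset]%M.

Lemma word_monomialE a i :
  word_monomial a i = if i is i'.+1 then nth 0 a i' else 0.
Proof.
rewrite /word_monomial cmE fsfunE; case: i => [|i].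
  by rewrite ifF //; apply/negbTE; rewrite in_fset mem_iota.
case: ifP => //; rewrite in_fset /= mem_iota add1n ltnS /= => /negbT.
by rewrite -leqNgt => le; rewrite nth_default.
Qed.


Section Diagram.
Variables la mu : seq nat.
Notation row := (@row_of la mu).
Notation col := (@col_of la mu).
Implicit Types (z : box la mu).

Lemma rpp_fillingP a (P : {ffun box la mu -> nat}) :
  (rpp P /\ rpp_monomial P = word_monomial a) <->
  is_filling row col a 1 [set: box la mu] P.
Proof.
have colsE i : cols_containing P i = col @: [set x in [set: box la mu] | P x == i].
  rewrite /cols_containing; apply/setP => c; apply/imsetP/imsetP => -[z zP ->];
    by exists z => //; move: zP; rewrite !inE.
split=> [[[pos mr mc] em]|[_ bnd mono cols]].
  have mP i : #|cols_containing P i| = if i is i'.+1 then nth 0 a i' else 0.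
    by rewrite -rpp_monomialE em word_monomialE.
  split=> [z|z _|x y _ _|i lt]; first by rewrite inE.
  - rewrite pos add1n ltnS leqNgt; apply/negP => lt.
    have := mP (P z); case e: (P z) lt => [//|k]; rewrite ltnS => lt.
    rewrite nth_default // => /eqP; rewrite cards_eq0 => /eqP e0.
    have: col z \in cols_containing P k.+1.
      by rewrite colsE; apply: imset_f; rewrite !inE e eqxx.
    by rewrite e0 inE.
  - by case/orP => /andP[/eqP e l]; [apply: mr|apply: mc].
  - by have := mP i.+1; rewrite colsE.
have bnd' z : 0 < P z < 1 + size a by apply: bnd; rewrite inE.
split.
  split=> [z|x y e l|x y e l]; first by case/andP: (bnd' z).
    by apply: mono; rewrite ?inE // /northwest e l eqxx.
  by apply: mono; rewrite ?inE // /northwest e l eqxx orbT.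
apply/eqP/cmP => i; rewrite rpp_monomialE word_monomialE.
case: i => [|i].
  apply/eqP; rewrite cards_eq0 colsE imset_eq0; apply/eqP/setP => z; rewrite !inE.
  by apply/negP => /eqP e; have := bnd' z; rewrite e.
have [lt|le] := ltnP i (size a); first by rewrite colsE; apply: (cols i).
rewrite nth_default //; apply/eqP; rewrite cards_eq0 colsE imset_eq0.
apply/eqP/setP => z; rewrite !inE; apply/negP => /eqP e.
by have /andP[_] := bnd' z; rewrite e add1n ltnS ltnNge le.
Qed.

Lemma dual_grothendieck_word a :
  dual_grothendieck la mu (word_monomial a) =
  (num_fillings row col a [set: box la mu])%:R%R.
Proof.
pose r := fillings row col a 1 [set: box la mu].
have rP P : P \in r <-> rpp P /\ rpp_monomial P = word_monomial a.
  by rewrite rpp_fillingP; split=> [/is_fillingP|] h; [exact: h|apply/is_fillingP].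
rewrite /dual_grothendieck (@fsbigop.fsbigE _ _ _ _ _ r).
- rewrite -(size_fillings row col a 1) -sum1_size natr_sum.
  rewrite big_seq_cond [RHS]big_seq; apply: eq_big => P.
    by apply: andb_idr => /rP[Pr _]; rewrite classical_sets.mem_set.
  by case/andP => /rP[_ ->] _; rewrite eqxx.
- exact: fillings_uniq.
- by move=> P /rP[].
- move=> P Pr; case: eqP => // e; have -> // : P \in r by apply/rP.
Qed.

(** * Bottleneck edges of a skew shape *)

Hypothesis skew : is_skew_shape la mu.

Lemma partition_nth s i j : is_partition s -> i <= j -> nth 0 s j <= nth 0 s i.
Proof.
move=> /andP[ss _] le; have [lt|ge] := ltnP j (size s); last by rewrite nth_default.
have tr : transitive geq by move=> x y z /= yx zy; apply: leq_trans zy yx.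
by apply: (sorted_leq_nth tr leqnn 0 ss); rewrite ?inE // (leq_ltn_trans le).
Qed.

Lemma la_anti i j : i <= j -> nth 0 la j <= nth 0 la i.
Proof. by case: skew => h _ _; apply: partition_nth. Qed.

Lemma mu_anti i j : i <= j -> nth 0 mu j <= nth 0 mu i.
Proof. by case: skew => _ h _; apply: partition_nth. Qed.

Lemma box_in z : nth 0 mu (row z) <= col z < nth 0 la (row z).
Proof. exact: (valP z). Qed.

Lemma box_exists r c : in_skew la mu r c ->
  exists z, (row z = r :> nat) /\ (col z = c :> nat).
Proof.
move=> rc; have /andP[_ lt] := rc.
have ltr : r < size la by rewrite ltnNge; apply/negP => le; rewrite nth_default in lt.
have ltc : c < head 0 la by apply: leq_trans lt _; rewrite -nth0 la_anti.
pose rc' := (Ordinal ltr, Ordinal ltc) : 'I_(size la) * 'I_(head 0 la).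
by exists (Sub rc' rc : box la mu); rewrite /row_of /col_of SubK.
Qed.

Lemma box_inj (x y : box la mu) : row x = row y -> col x = col y -> x = y.
Proof.
move=> er ec; apply: val_inj.
by rewrite [val x]surjective_pairing [val y]surjective_pairing; congr pair.
Qed.

Lemma southwest_closed_box : southwest_closed row col [set: box la mu].
Proof.
move=> p q _ _ rpq cpq.
have /andP[m1 l1] := box_in p; have /andP[m2 l2] := box_in q.
have [|z [rz cz]] := @box_exists (row q) (col p).
  by rewrite /in_skew (leq_trans (mu_anti rpq) m1) (leq_ltn_trans cpq l2).
by exists z; split; rewrite ?inE //; apply: val_inj.
Qed.

Notation K := (core row col [set: box la mu]).

Lemma mem_core_box z : (z \in K) = in_skew la mu (row z).+1 (col z).
Proof.
have /andP[m1 l1] := box_in z.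
apply/coreP/idP => [[_ [w [_ cw lt]]]|/box_exists[w [rw cw]]].
  have /andP[m2 l2] := box_in w.
  rewrite /in_skew (leq_trans (mu_anti _) m1) //=; apply: leq_trans (la_anti lt).
  by rewrite -cw.
split; rewrite ?inE //; exists w; rewrite ?inE; split=> //; first exact: val_inj.
by rewrite rw.
Qed.

Lemma northeast_closed_core : northeast_closed row col K.
Proof.
move=> p q; rewrite !mem_core_box => pK qK rpq cpq.
have /andP[m1 l1] := box_in p; have /andP[m2 l2] := qK.
have l3 : col q < nth 0 la (row p).+1 by apply: leq_trans l2 (la_anti _).
have [|z [rz cz]] := @box_exists (row p) (col q).
  rewrite /in_skew (leq_trans m1 cpq) /=; apply: leq_trans l3 (la_anti _); exact: leqnSn.
exists z; rewrite mem_core_box rz cz /in_skew l3.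
have m3 := leq_trans (mu_anti (leqnSn _)) (leq_trans m1 cpq).
by split; rewrite ?andbT ?m3 //; apply: val_inj.
Qed.

(** Row [row z] of the core is the interval of columns from [nth 0 mu (row z)] up
    to, but excluding, [nth 0 la (row z).+1].  It is reduced to [col z] exactly
    when both bounds are tight. *)
Lemma row_singletons_box z :
  (z \in row_singletons row K) = bottleneck_edge la mu (row z) (col z).
Proof.
have zb : in_skew la mu (row z) (col z) := box_in z.
have /andP[m1 l1] := box_in z.
apply/row_singletonsP/and4P => [[]|[_ zK /eqP em /eqP el]].
  rewrite mem_core_box => zK uniq_z; have /andP[m2 l2] := zK; split=> //.
    move: m1; rewrite leq_eqVlt => /orP[//|lt].
    have m3 : nth 0 mu (row z) <= (col z).-1 by rewrite -ltnS (ltn_predK lt).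
    have l3 : (col z).-1 < nth 0 la (row z).+1 by apply: leq_ltn_trans (leq_pred _) l2.
    have [|y [ry cy]] := @box_exists (row z) (col z).-1.
      rewrite /in_skew m3 /=; apply: leq_trans l3 (la_anti _); exact: leqnSn.
    have eyz : y = z.
      apply: uniq_z; last exact: val_inj.
      by rewrite mem_core_box ry cy /in_skew l3 (leq_trans (mu_anti (leqnSn _)) m3).
    move: cy lt; rewrite eyz; case: (nat_of_ord (col z)) => //= k /eqP.
    by rewrite eqn_leq ltnn.
  move: l2; rewrite leq_eqVlt eq_sym => /orP[//|lt].
  have m3 : nth 0 mu (row z) <= (col z).+1 by apply: leq_trans m1 _.
  have [|y [ry cy]] := @box_exists (row z) (col z).+1.
    rewrite /in_skew m3 /=; apply: leq_trans lt (la_anti _); exact: leqnSn.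
  have eyz : y = z.
    apply: uniq_z; last exact: val_inj.
    by rewrite mem_core_box ry cy /in_skew lt (leq_trans (mu_anti (leqnSn _)) m3).
  by move: cy; rewrite eyz => /eqP; rewrite eqn_leq ltnn andbF.
split=> [|y]; rewrite mem_core_box // => /andP[_ ly] er; apply: box_inj => //.
apply: val_inj; apply/eqP; rewrite eqn_leq; move: ly; rewrite er el ltnS => -> /=.
by have /andP[] := box_in y; rewrite er em.
Qed.

Lemma count_iota_ord (p : pred nat) k : count p (iota 0 k) = #|[set i : 'I_k | p i]|.
Proof.
have -> : iota 0 k = index_iota 0 k by rewrite /index_iota subn0.
rewrite -sum1_count big_mkord -sum1_card; apply: eq_bigl => i; by rewrite inE.
Qed.

Lemma count_bottleneck (c : 'I_(head 0 la)) :
  count (bottleneck_edge la mu ^~ c) (iota 0 (size la)) =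
  #|[set z in row_singletons row K | col z == c]|.
Proof.
rewrite count_iota_ord -(@card_in_imset _ _ row).
  apply: eq_card => r; rewrite inE; apply/idP/imsetP => [be|[z]].
    have /and4P[rc _ _ _] := be; have [z [rz cz]] := box_exists rc.
    have er : row z = r by apply: val_inj.
    have ec : col z = c by apply: val_inj.
    by exists z; rewrite // inE row_singletons_box er ec be eqxx.
  by rewrite inE row_singletons_box => /andP[be /eqP <-] ->.
move=> x y; rewrite in_set => /andP[_ /eqP cx]; rewrite in_set => /andP[_ /eqP cy] e.
by apply: box_inj; rewrite ?cx ?cy.
Qed.

Lemma ncols_ncol : ncols la mu = ncol col [set: box la mu].
Proof.
rewrite /ncols /nonempty_cols size_filter count_iota_ord; apply: eq_card => c.
rewrite inE; apply/hasP/imsetP => [[r _ /box_exists[z [_ cz]]]|[z _ ->]].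
  by exists z; rewrite ?inE //; apply: val_inj.
by exists (row z : nat); [rewrite mem_iota /=|exact: box_in].
Qed.

(** Empty columns contribute 0, so the sum may range over all columns. *)
Lemma sum_bottleneck :
  \sum_(i < ncols la mu) bottleneck la mu i ^ 2 =
  \sum_(c < head 0 la) #|[set z in row_singletons row K | col z == c]| ^ 2.
Proof.
pose F c := count (bottleneck_edge la mu ^~ c) (iota 0 (size la)) ^ 2.
transitivity (\sum_(c <- nonempty_cols la mu) F c).
  by rewrite (big_nth 0) big_mkord.
rewrite big_filter big_mkcond /=.
transitivity (\sum_(c <- iota 0 (head 0 la)) F c).
  apply: eq_bigr => c _; case: ifP => // /negbT none; rewrite /F.
  suff -> : count (bottleneck_edge la mu ^~ c) (iota 0 (size la)) = 0 by [].
  apply/eqP; rewrite -leqn0 leqNgt -has_count; apply: contra none.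
  by apply: sub_has => r /and4P[].
have -> : iota 0 (head 0 la) = index_iota 0 (head 0 la) by rewrite /index_iota subn0.
by rewrite big_mkord; apply: eq_bigr => c _; rewrite /F count_bottleneck.
Qed.

(** The right-hand side depends only on how many rows of the core there are and
    on the multiset of the ranks of their leftmost boxes among the single-box
    rows of their column. *)
Lemma dual_grothendieck_alternating (t : {poly int}) M N :
  #|box la mu| < N -> head 0 la <= M -> (1 - t = 'X)%R ->
  (alternating_sum t M N (fun a =>
     (dual_grothendieck la mu (word_monomial (1 :: rcons a (ncols la mu))))%:~R) =
   \sum_(z in leftmost row col K)
      'X^(nrow row K - #|row_singletons row K :&: column_upto row col K z|))%R.
Proof.
move=> ltN leM et.
under eq_alternating_sum => a do rewrite dual_grothendieck_word ncols_ncol mulrz_nat.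
have cD := southwest_closed_box.
rewrite alternating_sum_one_column ?cardsT // et.
rewrite (sum_one_column_ideals box_inj) //; last exact: southwest_closed_core.
by apply: eq_bigr => z _; rewrite -(nrow_column_upto box_inj K z) addnK.
Qed.

Lemma sum_bottleneck_leftmost :
  \sum_(z in leftmost row col K)
    (2 * (nrow row K -
       (nrow row K - #|row_singletons row K :&: column_upto row col K z|)) - 1) =
  \sum_(i < ncols la mu) bottleneck la mu i ^ 2.
Proof.
rewrite sum_bottleneck -(sum_leftmost_ranks box_inj northeast_closed_core).
apply: eq_bigr => z _; rewrite subKn //.
by rewrite -[leqRHS](nrow_column_upto box_inj K z) leq_addl.
Qed.

End Diagram.

(** * Comparing two shapes *)

Theorem corollary3p15 (la mu ga nu : seq nat) :
  is_skew_shape la mu -> is_skew_shape ga nu ->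
  dual_grothendieck la mu = dual_grothendieck ga nu ->
  ncols la mu = ncols ga nu /\
  \sum_(i < ncols la mu) bottleneck la mu i ^ 2 =
  \sum_(i < ncols ga nu) bottleneck ga nu i ^ 2.
Proof.
move=> skew1 skew2 eg.
have en : ncols la mu = ncols ga nu.
  (* Only the constant filling uses a single variable, once per column. *)
  have := congr1 (fun g => g (word_monomial [:: ncols la mu])) eg.
  rewrite !dual_grothendieck_word !num_fillings1 -!ncols_ncol // eqxx.
  by case: eqP.
split=> //.
(* Bounds good for both shapes, so that the same coefficients are summed. *)
pose N := (#|box la mu| + #|box ga nu|).+1; pose M := head 0 la + head 0 ga.
pose t := (1 - 'X : {poly int})%R.
have et : (1 - t = 'X)%R by rewrite /t opprB addrC subrK.
have alt1 : alternating_sum t M N _ = _ := dual_grothendieck_alternating skew1 _ _ et.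
have alt2 : alternating_sum t M N _ = _ := dual_grothendieck_alternating skew2 _ _ et.
rewrite -en -eg alt1 ?ltnS ?leq_addr ?leq_addl // in alt2.
have eh := eq_sum_exponents (alt2 isT isT).
have eS := eh (fun=> 1); rewrite !sum1_card !(card_leftmost (@box_inj _ _)) in eS.
rewrite -(sum_bottleneck_leftmost skew1) -(sum_bottleneck_leftmost skew2).
by rewrite (eh (fun e => 2 * (_ - e) - 1)) eS.
Qed.
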